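(* The maps $B\mapsto \mathbf{x}_B$ and $\mathbf{x}\mapsto B_{\mathbf{x}}$ are mutually inverse bijections between the set consisting of all indecomposable subbimodules of ${}_AA_A$ together with the zero subbimodule, and the set of all special functions for $Q$ (the zero subbimodule corresponding to the zero function).
   Context: $\Bbbk$ is an algebraically closed field. $Q$ is an oriented connected tree with vertex set $Q_0=\{1,2,\dots,n\}$, $n>1$. $\mathbf{K}(Q)$ is the set of all vertices that are sinks or sources, and $\mathbf{K}'(Q)$ is the set of all $i\in\mathbf{K}(Q)$ with $\deg_Q(i)\geq 2$. $Q$ is assumed to be admissible: every vertex of degree at least $3$ belongs to $\mathbf{K}(Q)$. It is also assumed that $\mathbf{K}'(Q)\neq\varnothing$ (equivalently, $Q$ is not isomorphic to $1\to 2\to\dots\to m$). $A$ is the path algebra of $Q$ over $\Bbbk$; $e_i$ is the trivial path at $i$; if there is an oriented path from $i$ to $j$, the unique such path is denoted $\mathtt{a}_{ji}$, and it spans $e_jAe_i$. $P_i=Ae_i$ (left modules). Subbimodules of ${}_AA_A$ are the two-sided ideals of $A$. For $i\in Q_0$, $\overline{i}$ is the set of all vertices to which there is an oriented (possibly trivial) path from $i$. A function $\alpha:Q_0\to Q_0\cup\{0\}$ is a path function if $\alpha(i)\in\overline{i}\cup\{0\}$ for all $i$. A path function is monotone if for all $i,j$ with $i\in\overline{j}$ and $\alpha(i)\neq 0$ we have $\alpha(j)\neq 0$ and $\alpha(i)\in\overline{\alpha(j)}$. A chain in $Q$ is a subtree isomorphic to $1\to2\to\dots\to m$ for some $m$;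 a maximal chain is one maximal under inclusion; $\mathfrak{M}_Q$ is the set of maximal chains. The support $\mathrm{supp}(\alpha)$ is the (not necessarily full) subgraph of $Q$ given by the union of all $X\in\mathfrak{M}_Q$ which contain some $i\in Q_0$ with $\alpha(i)\in X$. A special function is a monotone path function $\alpha$ whose support is connected (the empty graph counts as connected) and such that $\alpha(i)=0$ for $i\in\mathbf{K}(Q)\cap\mathrm{supp}(\alpha)$ implies $\deg_{\mathrm{supp}(\alpha)}(i)=1$. For an indecomposable subbimodule $B$ of ${}_AA_A$ and $i\in Q_0$ put $B_i=\bigoplus_{j}e_jBe_i$, a left $A$-module which is zero or indecomposable projective. The function $\mathbf{x}_B:Q_0\to Q_0\cup\{0\}$ is defined by $\mathbf{x}_B(i)=0$ if $B_i=0$, and otherwise $\mathbf{x}_B(i)$ is the unique vertex with $B_i\cong P_{\mathbf{x}_B(i)}$; for $B=0$, $\mathbf{x}_B$ is the zero function. For a special function $\mathbf{x}$, $B_{\mathbf{x}}$ is the linear span of all $\mathtt{a}_{ts}$ with $\mathbf{x}(s)\neq 0$ and $t\in\overline{\mathbf{x}(s)}$. *)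

(* Defs.v *)
From HB Require Import structures.
From mathcomp Require Import all_boot all_order all_algebra all_field.
From mathcomp Require Import boolp.

Set Implicit Arguments.
Unset Strict Implicit.
Unset Printing Implicit Defensive.

Import GRing.Theory.
Local Open Scope ring_scope.

Definition adj (T : finType) (e : rel T) : rel T := fun x y => e x y || e y x.

(* Vertices are numbered from 0.  A tree has no multiple edges, so a relation is
   enough for the arrows; cycles of size 1 and 2 in the underlying graph are
   loops and double edges, excluded by the asymmetry field. *)
Record oriented_tree (n : nat) := OrientedTree {
  arrow :> rel 'I_n;
  tree_nonempty : (0 < n)%N;
  arrow_asym : forall x y, arrow x y -> ~~ arrow y x;
  tree_connected : forall x y, connect (adj arrow) x y;
  tree_acyclic : forall c : seq 'I_n, (2 < size c)%N -> ~ ucycle (adj arrow) c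
}.

Section Combinatorics.

Variables (n : nat) (Q : oriented_tree n).
Implicit Types (i j : 'I_n) (alpha : {ffun 'I_n -> option 'I_n}).

Definition sink i := [forall j, ~~ Q i j].
Definition source i := [forall j, ~~ Q j i].
Definition degQ i := #|[set j | adj Q i j]|.
(* K(Q) and K'(Q) *)
Definition KQ := [set i | sink i || source i].
Definition KQ' := [set i in KQ | (2 <= degQ i)%N].
Definition admissible := forall i, (3 <= degQ i)%N -> i \in KQ.

Definition over i := [set j | connect Q i j].

(* Not necessarily full subgraphs: a vertex set and an arrow set. *)
Definition graph := ({set 'I_n} * {set 'I_n * 'I_n})%type.
Implicit Types X Y : graph.

Definition is_subgraph X :=
  [forall a in X.2, [&& Q a.1 a.2, a.1 \in X.1 & a.2 \in X.1]].
Definition sub_graph X Y := (X.1 \subset Y.1) && (X.2 \subset Y.2).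

(* [h] is an isomorphism from 1 -> 2 -> ... -> m to X; injectivity of [h]
   makes the bound m <= n harmless. *)
Definition is_chain X :=
  is_subgraph X &&
  [exists m : 'I_n.+1, exists h : {ffun 'I_m -> 'I_n},
    [&& (0 < m)%N, injectiveb h, X.1 == [set h i | i : 'I_m]
      & [forall i, forall j, ((h i, h j) \in X.2) == (j == i.+1 :> nat)]]].
Definition maximal_chain X :=
  is_chain X && [forall Y : graph, is_chain Y && sub_graph X Y ==> (Y == X)].

(* The value 0 of a path function is encoded as [None]. *)
Definition path_function alpha :=
  forall i j, alpha i = Some j -> j \in over i.

Definition monotone alpha :=
  forall i j v, i \in over j -> alpha i = Some v ->
    exists2 w, alpha j = Some w & v \in over w.

Definition meets alpha X :=
  [exists i in X.1, exists j in X.1, alpha i == Some j].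
Definition supp alpha : graph :=
  (\bigcup_(X : graph | maximal_chain X && meets alpha X) X.1,
   \bigcup_(X : graph | maximal_chain X && meets alpha X) X.2).

Definition edge X : rel 'I_n := adj (fun i j => (i, j) \in X.2).
Definition connected_graph X :=
  forall i j, i \in X.1 -> j \in X.1 -> connect (edge X) i j.
Definition deg X i := #|[set j | edge X i j]|.

Definition special alpha : Prop :=
  [/\ path_function alpha, monotone alpha, connected_graph (supp alpha)
    & forall i, i \in KQ :&: (supp alpha).1 -> alpha i = None ->
        deg (supp alpha) i = 1%N].

End Combinatorics.

(* The path x0 -> x1 -> ... -> xm is (x0, [:: x1; ...; xm]). *)
Record qpath (n : nat) (Q : oriented_tree n) := QPath {
  qseq : 'I_n * seq 'I_n;
  qseqP : path Q qseq.1 qseq.2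
}.

Section PathType.

Variables (n : nat) (Q : oriented_tree n).
Implicit Types (i : 'I_n) (p q r : qpath Q).

HB.instance Definition _ := [isSub for @qseq n Q].
HB.instance Definition _ := [Countable of qpath Q by <:].

Lemma arrow_irr i : Q i i = false.
Proof. by apply/negP => Qii; move: (arrow_asym Qii); rewrite Qii. Qed.

Lemma uniq_qpath x s : path Q x s -> uniq (x :: s).
Proof.
elim: s x => [|y s IHs] x //= /andP[Qxy ys].
have /= -> := IHs _ ys; rewrite andbT; apply/negP => xs.
have {xs} : x \in y :: s by [].
case: (eqVneq x y) => [eqxy|neqxy]; first by rewrite -eqxy arrow_irr in Qxy.
rewrite inE (negPf neqxy) /= => xs.
case/splitPr: xs ys (IHs _ ys) => s1 s2.
rewrite cat_path /= => /and3P[ys1 Qx _].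
rewrite -[_ && _]/(uniq ((y :: s1) ++ x :: s2)) cat_uniq => /and3P[us1 /hasPn /(_ x)].
rewrite mem_head => /(_ isT) /= xNs1 _.
have cyc : cycle Q (x :: y :: s1) by rewrite /= rcons_path ys1 Qxy.
case: s1 => [|z s1] in ys1 Qx us1 xNs1 cyc *.
  by move: (arrow_asym Qxy); rewrite Qx.
have // := @tree_acyclic _ Q (x :: y :: z :: s1) isT.
case; apply/andP; split; last by rewrite cons_uniq xNs1.
by apply: sub_path cyc => a b; rewrite /adj => ->.
Qed.

Lemma size_qpath p : (size (qseq p).2 <= n)%N.
Proof.
have /= /andP[_ u] := uniq_qpath (qseqP p).
by rewrite -[n in (_ <= n)%N]card_ord -(card_uniqP u) max_card.
Qed.

Definition qpath_code p : 'I_n * n.-bseq 'I_n :=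
  ((qseq p).1, Bseq (size_qpath p)).
Definition qpath_decode (c : 'I_n * n.-bseq 'I_n) : option (qpath Q) :=
  insub (c.1, val c.2).
Lemma qpath_codeK : pcancel qpath_code qpath_decode.
Proof. by case=> [[x s] xs]; rewrite /qpath_decode /= insubT. Qed.
HB.instance Definition _ :=
  isFinite.Build (qpath Q) (pcan_enumP qpath_codeK).

Definition qsrc p : 'I_n := (qseq p).1.
Definition qtgt p : 'I_n := last (qseq p).1 (qseq p).2.

Definition trivial_path i : qpath Q := @QPath n Q (i, [::]) isT.

(* Right-to-left composition: first p, then q. *)
Definition qcomp q p : option (qpath Q) :=
  if qtgt p == qsrc q then insub (qsrc p, (qseq p).2 ++ (qseq q).2) else None.

Lemma qcompP q p r :
  reflect (qtgt p = qsrc q /\ qseq r = (qsrc p, (qseq p).2 ++ (qseq q).2))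
          (qcomp q p == Some r).
Proof.
rewrite /qcomp; case: (qtgt p =P qsrc q) => [e|ne]; last first.
  by apply: (iffP eqP) => // -[].
have pq : path Q (qsrc p) ((qseq p).2 ++ (qseq q).2).
  by rewrite cat_path qseqP /= -/(qtgt p) e qseqP.
rewrite insubT; apply: (iffP eqP) => [[<-]|[_ er]] //=.
by congr Some; apply: val_inj; rewrite /= er.
Qed.

Lemma qcomp_src q p r : qcomp q p == Some r -> qsrc r = qsrc p.
Proof. by move/qcompP => -[_]; rewrite /qsrc => ->. Qed.

Lemma qcomp_tgt q p r : qcomp q p == Some r -> qtgt r = qtgt q.
Proof.
by move/qcompP => -[e]; rewrite /qtgt => -> /=; rewrite last_cat -/(qtgt p) e.
Qed.

Lemma qcompA q1 q2 q3 :
  obind (qcomp q1) (qcomp q2 q3) = obind (qcomp^~ q3) (qcomp q1 q2).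
Proof.
case e23: (qcomp q2 q3) => [r23|] /=; case e12: (qcomp q1 q2) => [r12|] //=.
- move/eqP: (e23) => /[dup] /qcomp_tgt t23 /qcompP[t3 s23].
  move/eqP: (e12) => /[dup] /qcomp_src s12 /qcompP[t2 s12'].
  rewrite /qcomp t23 s12 t2 t3 !eqxx; congr insub.
  by rewrite /qsrc s23 s12' /= catA.
- move/eqP: (e23) => /qcomp_tgt t23.
  move: e12; rewrite /qcomp t23; case: eqP => // t2.
  rewrite insubT // cat_path qseqP /= -/(qtgt q2) t2 qseqP //.
- move/eqP: (e12) => /qcomp_src s12.
  move: e23; rewrite /qcomp s12; case: eqP => // t2.
  by rewrite insubT // cat_path qseqP /= -/(qtgt q3) t2 qseqP.
Qed.

Lemma qcomp1l i p r :
  (qcomp (trivial_path i) p == Some r) = (i == qtgt p) && (p == r).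
Proof.
apply/qcompP/andP => [[e s]|[/eqP-> /eqP->]]; last first.
  by rewrite cats0; split=> //; rewrite [LHS]surjective_pairing.
split; first by rewrite e.
by apply/eqP/val_inj; rewrite /= s cats0 [LHS]surjective_pairing.
Qed.

Lemma qcomp1r i p r :
  (qcomp p (trivial_path i) == Some r) = (i == qsrc p) && (p == r).
Proof.
apply/qcompP/andP => [[/= e s]|[/eqP-> /eqP->]]; last first.
  by split=> //; rewrite [LHS]surjective_pairing.
split; first by rewrite -e.
by apply/eqP/val_inj; rewrite /= s -[i]/(qtgt (trivial_path i)) e [LHS]surjective_pairing.
Qed.

End PathType.

Section PathAlgebra.

Variables (k : fieldType) (n : nat) (Q : oriented_tree n).

Definition path_algebra : Type := {ffun qpath Q -> k^o}.
HB.instance Definition _ := Vector.copy path_algebra {ffun qpath Q -> k^o}.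

Implicit Types (f g h : path_algebra) (p q r : qpath Q).

Definition pelt p : path_algebra := [ffun q => (q == p)%:R].

Definition pmul f g : path_algebra :=
  [ffun r => \sum_(q : qpath Q) \sum_(p | qcomp q p == Some r) f q * g p].

Definition pone : path_algebra := \sum_i pelt (trivial_path Q i).

Lemma poneE p : pone p = \sum_i (p == trivial_path Q i)%:R.
Proof. by rewrite sum_ffunE; apply: eq_bigr => i _; rewrite ffunE. Qed.

Lemma pmulA : associative pmul.
Proof.
move=> f g h; apply/ffunP => r; rewrite !ffunE.
transitivity (\sum_q1 \sum_q2 \sum_(q3 |
    obind (qcomp q1) (qcomp q2 q3) == Some r) f q1 * g q2 * h q3 : k).
  apply: eq_bigr => q1 _.
  under eq_bigr => p _ do rewrite ffunE mulr_sumr.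
  rewrite exchange_big /=; apply: eq_bigr => q2 _.
  under eq_bigr => p _ do rewrite mulr_sumr.
  rewrite (exchange_big_dep xpredT) //= [RHS]big_mkcond; apply: eq_bigr => q3 _.
  case: (qcomp q2 q3) => [p0|] /=; last by rewrite big1 // => p /andP[].
  rewrite (eq_bigl (fun p => (p == p0) && (qcomp q1 p0 == Some r))); last first.
    move=> p; rewrite (inj_eq Some_inj) andbC eq_sym.
    by case: eqP => // ->.
  case: (_ == Some r); last by rewrite big_pred0 // => p; rewrite andbF.
  by rewrite (big_pred1 p0) ?mulrA // => p; rewrite andbT.
symmetry.
under eq_bigr => q _.
  under eq_bigr => q3 _ do rewrite ffunE mulr_suml.
  over.
under eq_bigr => q _ do rewrite exchange_big.
rewrite exchange_big; apply: eq_bigr => q1 _ /=.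
under eq_bigr => q _ do under eq_bigr => q3 _ do rewrite mulr_suml.
under eq_bigr => q _ do rewrite (exchange_big_dep xpredT) //=.
rewrite exchange_big; apply: eq_bigr => q2 _ /=.
rewrite (exchange_big_dep xpredT) //= [RHS]big_mkcond.
apply: eq_bigr => q3 _ /=; rewrite qcompA.
case: (qcomp q1 q2) => [p0|] /=; last by rewrite big1 // => p /andP[].
rewrite (eq_bigl (fun p => (p == p0) && (qcomp p0 q3 == Some r))); last first.
  move=> p; rewrite (inj_eq Some_inj) andbC eq_sym.
  by case: eqP => // ->.
case: (_ == Some r); last by rewrite big_pred0 // => p; rewrite andbF.
by rewrite (big_pred1 p0) // => p; rewrite andbT.
Qed.


Lemma pmul1l : left_id pone pmul.
Proof.
move=> f; apply/ffunP => r; rewrite ffunE.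
under eq_bigr => q _ do under eq_bigr => p _ do rewrite poneE mulr_suml.
under eq_bigr => q _ do rewrite exchange_big /=.
rewrite exchange_big /= (bigD1 (qtgt r)) //= [X in _ + X]big1 ?addr0.
  rewrite (bigD1 (trivial_path Q (qtgt r))) //= [X in _ + X]big1 ?addr0.
    rewrite (big_pred1 r) => [|p]; first by rewrite eqxx mul1r.
    by rewrite /= qcomp1l; case: (eqVneq p r) => [->|]; rewrite ?eqxx ?andbF.
  by move=> q /negPf ->; rewrite big1 // => p _; rewrite mul0r.
move=> i neq; rewrite big1 // => q _; rewrite big1 // => p.
case: (eqVneq q (trivial_path Q i)) => [->|]; last by rewrite mul0r.
by rewrite qcomp1l => /andP[/eqP ip /eqP pr]; rewrite ip pr eqxx in neq.
Qed.

Lemma pmul1r : right_id pone pmul.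
Proof.
move=> f; apply/ffunP => r; rewrite ffunE.
under eq_bigr => q _ do under eq_bigr => p _ do rewrite poneE mulr_sumr.
under eq_bigr => q _ do rewrite exchange_big /=.
rewrite exchange_big /= (bigD1 (qsrc r)) //= [X in _ + X]big1 ?addr0.
  rewrite (bigD1 r) //= [X in _ + X]big1 ?addr0.
    rewrite (bigD1 (trivial_path Q (qsrc r))) ?qcomp1r ?eqxx //= mulr1.
    by rewrite big1 ?addr0 // => p /andP[_ /negPf->]; rewrite mulr0.
  move=> q /negPf neq; rewrite big1 // => p.
  case: (eqVneq p (trivial_path Q (qsrc r))) => [->|]; last by rewrite mulr0.
  by rewrite qcomp1r neq andbF.
move=> i neq; rewrite big1 // => q _; rewrite big1 // => p.
case: (eqVneq p (trivial_path Q i)) => [->|]; last by rewrite mulr0.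
by rewrite qcomp1r => /andP[/eqP ip /eqP pr]; rewrite ip pr eqxx in neq.
Qed.

Lemma pmulDl : left_distributive pmul +%R.
Proof.
move=> f g h; apply/ffunP => r; rewrite !ffunE -big_split /=.
apply: eq_bigr => q _; rewrite -big_split /=; apply: eq_bigr => p _.
by rewrite ffunE mulrDl.
Qed.

Lemma pmulDr : right_distributive pmul +%R.
Proof.
move=> f g h; apply/ffunP => r; rewrite !ffunE -big_split /=.
apply: eq_bigr => q _; rewrite -big_split /=; apply: eq_bigr => p _.
by rewrite ffunE mulrDr.
Qed.

Lemma pone_neq0 : pone != 0.
Proof.
pose i := Ordinal (tree_nonempty Q).
apply/eqP => /ffunP /(_ (trivial_path Q i)); rewrite poneE ffunE.
rewrite (bigD1 i) //= big1 ?addr0; first by apply/eqP/oner_neq0.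
move=> j /negPf nji; case: eqP => // /(congr1 (@qsrc n Q)) /= /eqP.
by rewrite eq_sym -[qsrc _]/j nji.
Qed.

HB.instance Definition _ := GRing.Zmodule_isNzRing.Build path_algebra
  pmulA pmul1l pmul1r pmulDl pmulDr pone_neq0.

Lemma pscaleAl (a : k) f g : a *: (f * g) = (a *: f) * g.
Proof.
apply/ffunP => r; rewrite !ffunE scaler_sumr; apply: eq_bigr => q _.
by rewrite scaler_sumr; apply: eq_bigr => p _; rewrite ffunE scalerAl.
Qed.
HB.instance Definition _ :=
  GRing.Lmodule_isLalgebra.Build k path_algebra pscaleAl.

Lemma pscaleAr (a : k) f g : a *: (f * g) = f * (a *: g).
Proof.
apply/ffunP => r; rewrite !ffunE scaler_sumr; apply: eq_bigr => q _.
rewrite scaler_sumr; apply: eq_bigr => p _; rewrite ffunE.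
by rewrite [LHS]mulrCA.
Qed.
HB.instance Definition _ :=
  GRing.Lalgebra_isAlgebra.Build k path_algebra pscaleAr.

HB.instance Definition _ := Algebra_isFalgebra.Build k path_algebra.

End PathAlgebra.

Section Bimodules.

Variables (k : fieldType) (A : falgType k).
Implicit Types (U W B : {vspace A}).

Definition subbimodule B : bool :=
  ({:A} * B <= B)%VS && (B * {:A} <= B)%VS.

Definition indecomposable_subbimodule B : Prop :=
  [/\ subbimodule B, B != 0%VS &
      forall B1 B2 : {vspace A}, subbimodule B1 -> subbimodule B2 ->
        (B1 + B2)%VS = B -> (B1 :&: B2)%VS = 0%VS -> B1 = 0%VS \/ B2 = 0%VS].

(* Isomorphism of left ideals U and W as left A-modules.  A linear map defined on
   U extends to A, so it is given here by an endomorphism of the space A. *)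
Definition left_module_iso U W : Prop :=
  exists f : 'End(A),
    [/\ (f @: U)%VS = W, {in U &, injective f}
      & forall a u, u \in U -> f (a * u) = a * f u].

End Bimodules.

Section Bijection.

Variables (k : fieldType) (n : nat) (Q : oriented_tree n).

Local Notation A := (path_algebra k Q).

Definition idem (i : 'I_n) : A := pelt k (trivial_path Q i).

(* P_i = A e_i *)
Definition proj (i : 'I_n) : {vspace A} := ({:A} * <[idem i]>)%VS.

(* B_i *)
Definition bimod_col (B : {vspace A}) (i : 'I_n) : {vspace A} :=
  (\sum_(j < n) <[idem j]> * B * <[idem i]>)%VS.

(* The junk value [None] taken when B_i is nonzero and isomorphic to no P_v does
   not occur for indecomposable B. *)
Definition x_of (B : {vspace A}) : {ffun 'I_n -> option 'I_n} :=
  [ffun i => if bimod_col B i == 0%VS then None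
             else [pick v | `[< left_module_iso (bimod_col B i) (proj v) >]]].

(* In a tree there is at most one path p from s to t; [pelt p] is a_{ts}. *)
Definition B_of (x : {ffun 'I_n -> option 'I_n}) : {vspace A} :=
  (\sum_(p : qpath Q | if x (qsrc p) is Some v then qtgt p \in over Q v else false)
     <[pelt k p]>)%VS.

End Bijection.

(* Main.v *)
(* A two-sided ideal B contains a_{ts} whenever it contains an element with a nonzero
   coefficient at a_{ts}, so it is spanned by a set S of paths that is closed under
   extension at both ends. Every nontrivial path lies on a single maximal chain (an
   interval from a source to a sink), and paths of S on different chains are related
   only through trivial paths of S at sinks or sources. Hence B is indecomposable when
   the chains that S meets, i.e. those of the support, form a connected graph all of
   whose junctions j satisfy a_{jj} in S. Conversely, when a_{jj} is not in S, the
   branches of the tree at j split B; this makes each column B_i cyclic and gives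
   degree 1 in the support. *)

Require Import Defs.
From HB Require Import structures.
From mathcomp Require Import all_boot all_order all_algebra all_field.
From mathcomp Require Import boolp.
(* ssreflect's [over] shadows the vertex set [over] otherwise. *)
Import Defs.
Import GRing.Theory.
Local Open Scope ring_scope.

Set Implicit Arguments.
Unset Strict Implicit.
Unset Printing Implicit Defensive.

(** * Oriented trees *)

Section Relations.

Variable T : finType.
Implicit Types (e : rel T) (P : pred T).

Lemma adj_sym e x y : adj e x y = adj e y x.
Proof. exact: orbC. Qed.

Lemma connect_last e x y :
  connect e x y -> x != y -> exists2 z, connect e x z & e z y.
Proof.
case/connectP=> p; elim/last_ind: p => [_ -> | p z _]; first by rewrite eqxx.
rewrite rcons_path last_rcons => /andP[xp pz -> _].
by exists (last x p) => //; apply/connectP; exists p.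
Qed.

Lemma connect_first e x y :
  connect e x y -> x != y -> exists2 z, e x z & connect e z y.
Proof.
case/connectP=> -[_ -> | z p /= /andP[xz zp] yE _]; first by rewrite eqxx.
by exists z => //; apply/connectP; exists p.
Qed.

(** On [P] each vertex has at most one successor, so the two walks from [i] coincide until the
    shorter one stops. *)
Lemma connect_linear e P i t t' :
  (forall x y, P x -> e x y -> P y) ->
  (forall x y z, P x -> e x y -> e x z -> y = z) ->
  P i -> connect e i t -> connect e i t' -> connect e t t' || connect e t' t.
Proof.
move=> Pe Pu Pi /connectP[p]; elim: p i Pi => [|y p IHp] i Pi /=.
  by move=> _ -> ->.
move=> /andP[iy yp] tE; case/connectP=> -[_ ->|z q /= /andP[iz zq] t'E].
  apply/orP; right; apply/connectP; exists (y :: p) => //=.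
  by rewrite iy.
apply: (IHp y) => //; first exact: Pe iy.
by rewrite (Pu _ _ _ Pi iy iz); apply/connectP; exists q.
Qed.

End Relations.

Section Trees.

Variables (n : nat) (Q : oriented_tree n).
Implicit Types (i j s t u v x y z : 'I_n) (p q r : qpath Q).

(** Apart from the isolated vertex [x], the connected components of this relation are the branches
    of the tree at [x]. *)
Definition avoid x : rel 'I_n := [rel u v | [&& adj Q u v, u != x & v != x]].

Lemma avoid_csym x : connect_sym (avoid x).
Proof.
apply: sym_connect_sym => u v; apply/and3P/and3P => -[uv ux vx]; split=> //.
  by rewrite adj_sym.
by rewrite adj_sym.
Qed.

Lemma arrow_neq x y : Q x y -> x != y.
Proof. by case: eqVneq => // ->; rewrite arrow_irr. Qed.

Lemma adj_neq x y : adj Q x y -> x != y.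
Proof. by case/orP=> /arrow_neq //; rewrite eq_sym. Qed.

(** This is the form in which acyclicity is used: a simple walk from [y] to [z] off [x] would close
    up through [x] to a cycle. So each branch at [x] contains only one neighbour of [x]. *)
Lemma no_detour x y z :
  adj Q x y -> adj Q x z -> connect (avoid x) y z -> y = z.
Proof.
move=> xy xz /connectP[p0 /shortenP[p yp uyp _] {p0} zE].
apply/eqP; case: p => [|w p] in yp uyp zE *; first by rewrite zE.
case: (@tree_acyclic _ Q [:: x, y, w & p] isT).
have av : all (predC1 x) (w :: p).
  apply/allP=> v; elim: (w :: p) y yp {uyp zE xy} => // a r IHr b /=.
  by case/andP=> /and3P[_ _ ax] /IHr ar; rewrite inE => /predU1P[->|/ar].
apply/andP; split; last first.
  rewrite cons_uniq uyp andbT inE negb_or adj_neq //=.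
  by apply/negP => /(allP av); rewrite /= eqxx.
have yp' : path (adj Q) y (w :: p) by apply: sub_path yp => a b /andP[].
rewrite -[cycle _ _]/(path (adj Q) x (rcons (y :: w :: p) x)) rcons_path.
by rewrite -[path _ _ _]/(adj Q x y && path (adj Q) y (w :: p)) xy yp' /= -[last w p]zE adj_sym.
Qed.

Lemma connect_antisym x y : connect Q x y -> connect Q y x -> x = y.
Proof.
case/connectP=> p xp ->{y} /connectP[q yq xE].
have /uniq_qpath : path Q x (p ++ q) by rewrite cat_path xp.
case: p => //= a p in xp yq xE * => /andP[/negP[]]; rewrite [X in X \in _]xE.
by rewrite -last_cat mem_last.
Qed.

Lemma arrow_connectF x y : Q x y -> connect Q y x = false.
Proof.
move=> xy; apply/negP => /(connect_antisym (connect1 xy)) eqxy.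
by rewrite eqxy arrow_irr in xy.
Qed.

(** The second hypothesis says in terms of reachability that [x] does not lie on a directed path
    from [y] to [t], so that [y] and [t] are in the same branch at [x]. *)
Lemma connect_avoid x y t :
  connect Q y t -> ~~ (connect Q y x && connect Q x t) -> connect (avoid x) y t.
Proof.
case/connectP=> p yp ->{t}; elim: p y yp => [|z p IHp] y /=.
  by rewrite connect0.
case/andP=> yz zp; have zt : connect Q z (last z p) by apply/connectP; exists p.
have yt := connect_trans (connect1 yz) zt.
rewrite negb_and => nx; have zx : ~~ (connect Q z x && connect Q x (last z p)).
  rewrite negb_and; case/orP: nx => [|->]; last by rewrite orbT.
  by apply: contraR; rewrite negb_or !negbK => /andP[zx _];
    apply: connect_trans zx; exact: connect1.
apply: connect_trans (IHp z zp zx); apply/connect1/and3P; split.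
- by rewrite /adj yz.
- by apply: contraTneq nx => <-; rewrite connect0 yt.
- by apply: contraNneq zx => <-; rewrite connect0.
Qed.

(** If the first arrows led to different vertices, the two remainders would join these through the
    common end without meeting [x], against [no_detour]. *)
Lemma path_inj x a b :
  path Q x a -> path Q x b -> last x a = last x b -> a = b.
Proof.
elim: a x b => [|y a IHa] x [|z b] //=.
- move=> _ xb xE; case/andP: (uniq_qpath (s := z :: b) xb) => /negP[].
  by rewrite [X in X \in _]xE mem_last.
- move=> xa _ xE; case/andP: (uniq_qpath (s := y :: a) xa) => /negP[].
  by rewrite -[X in X \in _]xE mem_last.
move=> /andP[xy ya] /andP[xz zb] lE.
suff yz : y = z by congr (_ :: _) => //; rewrite yz in ya lE *; apply: IHa ya zb lE.
have yt : connect Q y (last y a) by apply/connectP; exists a.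
have zt : connect Q z (last y a) by rewrite lE; apply/connectP; exists b.
apply: (@no_detour x); rewrite /adj ?xy ?xz //.
apply: (connect_trans (y := last y a)).
  by apply: connect_avoid; rewrite // arrow_connectF.
by rewrite avoid_csym; apply: connect_avoid; rewrite // arrow_connectF.
Qed.

Lemma qpath_inj p q : qsrc p = qsrc q -> qtgt p = qtgt q -> p = q.
Proof.
move=> sE tE; apply: val_inj; case: p q sE tE => [[x a] /= xa] [[y b] /= yb].
by rewrite /qsrc /qtgt /= => sE; rewrite -{}sE in yb *; move=> lE; rewrite (path_inj xa yb lE).
Qed.

Lemma qpath_connect p : connect Q (qsrc p) (qtgt p).
Proof. by apply/connectP; exists (qseq p).2; rewrite ?qseqP. Qed.

Lemma qpath_of s t : connect Q s t -> exists2 p : qpath Q, qsrc p = s & qtgt p = t.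
Proof. by case/connectP=> a sa ->; exists (@QPath _ Q (s, a) sa). Qed.

(** Paths are determined by their endpoints, so composition reduces to matching endpoints. *)
Lemma qcompE q p r : (qcomp q p == Some r) =
  [&& qtgt p == qsrc q, qsrc r == qsrc p & qtgt r == qtgt q].
Proof.
apply/idP/and3P => [e | [/eqP pq /eqP sr /eqP tr]].
  by case/qcompP: (e) => -> _; rewrite (qcomp_src e) (qcomp_tgt e).
case E: (qcomp q p) => [r'|]; last first.
  move: E; rewrite /qcomp pq eqxx insubT //.
  by rewrite cat_path qseqP /= -/(qtgt p) pq qseqP.
rewrite (inj_eq Some_inj); apply/eqP; move/eqP: E => E.
by apply: qpath_inj; rewrite ?(qcomp_src E) ?(qcomp_tgt E).
Qed.

Lemma connect_source s x : source Q s -> connect Q x s -> x = s.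
Proof.
move=> /forallP ss xs; apply/eqP/negPn/negP => /(connect_last xs)[z _ zs].
by move: (ss z); rewrite zs.
Qed.

Lemma connect_sink t x : sink Q t -> connect Q t x -> x = t.
Proof.
move=> /forallP st tx; apply/eqP/negPn/negP; rewrite eq_sym.
by case/(connect_first tx)=> z tz _; move: (st z); rewrite tz.
Qed.

(** The number of vertices below a vertex serves as a height function: extremal choices of it
    produce sources, sinks and the generators of columns. *)
Lemma card_over_lt x y : connect Q x y -> x != y ->
  (#|over Q y| < #|over Q x|)%N.
Proof.
move=> xy nxy; apply: proper_card; apply/properP; split.
  by apply/subsetP=> z; rewrite !inE; apply: connect_trans.
exists x; rewrite !inE // ?connect0 //; apply: contraNN nxy => yx.
by apply/eqP/connect_antisym.
Qed.

Lemma source_above v : exists2 s, source Q s & connect Q s v.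
Proof.
case: (@arg_maxnP _ v (fun s => connect Q s v) (fun s => #|over Q s|)) => [|s sv sm].
  exact: connect0.
exists s => //; apply/forallP => x; apply/negP => xs.
have /sm : connect Q x v by apply: connect_trans sv; apply: connect1.
by rewrite /= leqNgt card_over_lt ?connect1 ?arrow_neq.
Qed.

Lemma sink_below v : exists2 t, sink Q t & connect Q v t.
Proof.
case: (@arg_minnP _ v (fun t => connect Q v t) (fun t => #|over Q t|)) => [|t vt tm].
  exact: connect0.
exists t => //; apply/forallP => x; apply/negP => tx.
have /tm : connect Q v x by apply: connect_trans vt _; apply: connect1.
by rewrite leqNgt card_over_lt ?connect1 ?arrow_neq.
Qed.

Lemma source_sinkF v : (1 < n)%N -> source Q v -> sink Q v -> False.
Proof.
move=> n1 sv tv; have n0 : (0 < n)%N by exact: ltnW.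
have [w wv] : exists w, v != w.
  case: (eqVneq v (Ordinal n0)) => [->|]; last by exists (Ordinal n0).
  by exists (Ordinal n1); rewrite -val_eqE.
case: (connect_first (tree_connected Q v w) wv) => z /orP[vz|zv] _.
  by move/forallP: tv => /(_ z); rewrite vz.
by move/forallP: sv => /(_ z); rewrite zv.
Qed.

Lemma exists_pred v : ~~ source Q v -> exists u, Q u v.
Proof. by case/forallPn=> u; rewrite negbK; exists u. Qed.

Lemma exists_succ v : ~~ sink Q v -> exists u, Q v u.
Proof. by case/forallPn=> u; rewrite negbK; exists u. Qed.

Lemma not_source u v : Q u v -> ~~ source Q v.
Proof. by move=> uv; apply/forallPn; exists u; rewrite negbK. Qed.

Lemma not_sink u v : Q u v -> ~~ sink Q u.
Proof. by move=> uv; apply/forallPn; exists v; rewrite negbK. Qed.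

Lemma connect_not_source u v : connect Q u v -> u != v -> ~~ source Q v.
Proof. by move=> uv /(connect_last uv)[w _ /not_source]. Qed.

(** * Linearity of the reachability order under admissibility *)

Section Admissible.

Hypothesis hadm : admissible Q.

(** The vertex [i] is neither a source nor a sink, and a third neighbour would give it degree at
    least 3. *)
Lemma inner_neighbor i x y z : Q x i -> Q i y -> adj Q i z -> (z == x) || (z == y).
Proof.
move=> xi iy iz; apply/negPn/negP; rewrite negb_or => /andP[zx zy].
have : i \notin KQ Q by rewrite inE negb_or (not_sink iy) (not_source xi).
case/negP; apply: hadm.
have xy : x != y by apply/eqP => xy; case/negP: (arrow_asym iy); rewrite -xy.
have c3 : #|[set x; y; z]| = 3%N.
  by rewrite -setUA cardsU1 cards2 !inE negb_or xy eq_sym zx eq_sym zy.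
rewrite -c3.
apply: subset_leq_card; apply/subsetP=> w; rewrite !inE /adj.
by case/orP=> [/orP[]|] /eqP-> //; rewrite ?xi ?iy ?orbT.
Qed.

Lemma out_uniq i y z : ~~ source Q i -> Q i y -> Q i z -> y = z.
Proof.
case/exists_pred=> x xi iy iz.
have /(inner_neighbor xi iy)/orP[/eqP zx|/eqP //] : adj Q i z by rewrite /adj iz.
by case/negP: (arrow_asym iz); rewrite zx.
Qed.

Lemma in_uniq i y z : ~~ sink Q i -> Q y i -> Q z i -> y = z.
Proof.
case/exists_succ=> x ix yi zi.
have /(inner_neighbor yi ix)/orP[/eqP //|/eqP zx] : adj Q i z by rewrite /adj zi orbT.
by case/negP: (arrow_asym ix); rewrite -zx.
Qed.

(** Every vertex below a non-source is again a non-source, hence has at most one outgoing arrow. *)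
Lemma over_linear i t t' : ~~ source Q i -> connect Q i t -> connect Q i t' ->
  connect Q t t' || connect Q t' t.
Proof.
move=> si; apply: (connect_linear (P := fun i => ~~ source Q i)) => //.
  by move=> x y _; apply: not_source.
exact: out_uniq.
Qed.

Lemma under_linear i s s' : ~~ sink Q i -> connect Q s i -> connect Q s' i ->
  connect Q s s' || connect Q s' s.
Proof.
have crev u v : connect Q u v = connect [rel a b | Q b a] v u by rewrite connect_rev.
move=> si; rewrite !crev orbC.
apply: (connect_linear (P := fun i => ~~ sink Q i)) => //.
  by move=> x y _; apply: not_sink.
exact: in_uniq.
Qed.

Lemma sink_below_uniq i t t' : ~~ source Q i -> sink Q t -> sink Q t' ->
  connect Q i t -> connect Q i t' -> t = t'.
Proof.
move=> si st st' it it'; case/orP: (over_linear si it it') => /connect_sink -> //.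
Qed.

Lemma source_above_uniq i s s' : ~~ sink Q i -> source Q s -> source Q s' ->
  connect Q s i -> connect Q s' i -> s = s'.
Proof.
move=> ti ss ss' si si'; case/orP: (under_linear ti si si') => /connect_source -> //.
Qed.

End Admissible.

End Trees.

(** * Maximal chains and supports *)

Section Chains.

Variables (n : nat) (Q : oriented_tree n).
Implicit Types (s t u v w x y z : 'I_n) (X Y : graph n).

(* In a tree this is the graph of the unique directed path from s to t. *)
Definition interval s t : graph n :=
  ([set v | connect Q s v && connect Q v t],
   [set a | [&& Q a.1 a.2, connect Q s a.1 & connect Q a.2 t]]).

(** The path from [w] to [v] cannot return to [u], so both neighbours of [u] lie in one branch. *)
Lemma arrow_next u v w : Q u v -> Q u w -> connect Q w v -> w = v.
Proof.
move=> uv uw wv; apply: (@no_detour _ Q u); rewrite /adj ?uv ?uw //.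
by apply: connect_avoid; rewrite // arrow_connectF.
Qed.

Lemma mem_path_interval x a v :
  path Q x a -> (v \in x :: a) = connect Q x v && connect Q v (last x a).
Proof.
move=> xa; apply/idP/andP => [xav | [/connectP[b xb vE] /connectP[c vc lE]]].
  case/splitPl: xav xa => b c <-; rewrite cat_path last_cat => /andP[xb bc].
  by split; apply/connectP; [exists b | exists c].
have xbc : path Q x (b ++ c) by rewrite cat_path xb -vE.
rewrite (path_inj xa xbc); last by rewrite last_cat -vE.
by rewrite -cat_cons mem_cat vE mem_last.
Qed.

(** An arrow pointing back along the path would close a directed cycle, and one skipping ahead is
    excluded by [arrow_next]. *)
Lemma path_nth_arrow x a i j : path Q x a ->
  (i <= size a)%N -> (j <= size a)%N ->
  Q (nth x (x :: a) i) (nth x (x :: a) j) = (j == i.+1).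
Proof.
move=> xa ia ja; have arr l : (l < size a)%N ->
    Q (nth x (x :: a) l) (nth x (x :: a) l.+1) by move/pathP: xa; apply.
have con l m : (l <= m)%N -> (m <= size a)%N ->
    connect Q (nth x (x :: a) l) (nth x (x :: a) m).
  elim: m => [|m IHm]; first by rewrite leqn0 => /eqP->.
  rewrite leq_eqVlt => /predU1P[-> //|lm] ma.
  exact: connect_trans (IHm lm (ltnW ma)) (connect1 (arr _ ma)).
apply/idP/eqP => [ij | jE]; last by rewrite jE in ja *; apply: arr.
case: (leqP j i) => [ji | lij].
  by have := con _ _ ji ia; rewrite arrow_connectF.
have /(arrow_next ij) := arr i (leq_trans lij ja).
move=> /(_ (con _ _ lij ja)) /eqP.
by rewrite (nth_uniq x) ?(uniq_qpath xa) // 1?eq_sym => [/eqP|]; last exact: leq_trans lij ja.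
Qed.

Lemma path_interval_arrow x a i j : path Q x a ->
  (i <= size a)%N -> (j <= size a)%N ->
  ((nth x (x :: a) i, nth x (x :: a) j) \in (interval x (last x a)).2) =
    (j == i.+1).
Proof.
move=> xa ia ja; rewrite inE path_nth_arrow //=.
case: eqP => // _; have mem l : (l <= size a)%N -> nth x (x :: a) l \in x :: a.
  by move=> la; rewrite mem_nth.
by move: (mem _ ia) (mem _ ja); rewrite !mem_path_interval // => /andP[-> _] /andP[_ ->].
Qed.

Lemma is_chainP X :
  is_chain Q X <-> exists s t, connect Q s t /\ X = interval s t.
Proof.
split; last first.
  case=> s [_ [/connectP[a sa ->] ->]]; apply/andP; split.
    apply/forall_inP => -[u v]; rewrite !inE /= => /and3P[uv su vt].
    rewrite uv su vt (connect_trans su (connect1 uv)).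
    by rewrite (connect_trans (connect1 uv) vt).
  have ua := uniq_qpath sa.
  (* The vertices of the path are distinct, so their number is an admissible length in the
     definition of a chain. *)
  have ma : ((size a).+1 < n.+1)%N.
    have := max_card [in s :: a].
    by rewrite (card_uniqP ua) card_ord.
  apply/existsP; exists (Ordinal ma); apply/existsP.
  exists [ffun i => nth s (s :: a) (i : 'I_(size a).+1)]; apply/and4P; split=> //.
  - apply/injectiveP => i j; rewrite !ffunE => /eqP.
    by rewrite (nth_uniq s) // => /eqP/val_inj.
  - apply/eqP/setP => v; rewrite inE -mem_path_interval //.
    apply/(nthP s)/imsetP => [[i ia <-] | [i _ ->]].
      by exists (Ordinal ia); rewrite ?ffunE.
    by exists i; rewrite ?ffunE.
  by apply/forallP => i; apply/forallP => j; rewrite !ffunE path_interval_arrow // -ltnS.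
case/andP=> /forall_inP Xs /existsP[m /existsP[h]].
case: m h => [[//|m] mn] /= h /and3P[_ /eqP X1 /forallP X2].
(* The values of the embedding, read in order, form a directed path; its endpoints delimit the
   interval. *)
pose x := h ord0; pose a := [seq h (inord i.+1) | i <- iota 0 m].
have sa : size a = m by rewrite size_map size_iota.
have nthE (i : 'I_m.+1) : nth x (x :: a) i = h i.
  case: i => [[|i] im]; first by congr (h _); apply: val_inj.
  rewrite /= (nth_map 0%N) ?size_iota // nth_iota //.
  by congr (h _); apply: val_inj; rewrite /= inordK.
have X2E (i j : 'I_m.+1) : ((h i, h j) \in X.2) = (j == i.+1 :> nat).
  by move/forallP: (X2 i) => /(_ j) /eqP.
have xa : path Q x a.
  apply/(pathP x) => i; rewrite sa => im.
  have /eqP := X2E (Ordinal (leqW im)) (Ordinal (im : i.+1 < m.+1)%N).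
  rewrite eqxx -!nthE /= => /eqP/Xs /= /and3P[] //.
have hin v : v \in X.1 -> exists i : 'I_m.+1, v = h i.
  by rewrite X1 => /imsetP[i _ ->]; exists i.
have X1' : X.1 = (interval x (last x a)).1.
  apply/setP => v; rewrite inE -mem_path_interval // X1.
  apply/imsetP/(nthP x) => [[i _ ->] | [i]].
    by exists i; rewrite ?nthE // -?[size _]/(size a).+1 ?sa.
  rewrite /= sa => im <-; exists (Ordinal im) => //.
  by rewrite -nthE.
exists x, (last x a); split; first by apply/connectP; exists a.
rewrite [X]surjective_pairing [interval _ _]surjective_pairing -X1'; congr (_, _).
have ile (i : 'I_m.+1) : (i <= size a)%N by rewrite sa -ltnS.
have X2' i j : ((h i, h j) \in X.2) = ((h i, h j) \in (interval x (last x a)).2).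
  by rewrite -!nthE path_interval_arrow // !nthE X2E.
apply/setP => -[u v]; apply/idP/idP => uvX.
  have /= /and3P[_ /hin[i uE] /hin[j vE]] := Xs _ uvX.
  by rewrite uE vE -X2' -uE -vE.
have [/hin[i uE] /hin[j vE]] : u \in X.1 /\ v \in X.1.
  move: uvX; rewrite X1' !inE /= => /and3P[uv su vt].
  rewrite su vt (connect_trans su (connect1 uv)).
  by rewrite (connect_trans (connect1 uv) vt).
by rewrite uE vE X2' -uE -vE.
Qed.

(** A chain whose start is not a source, or whose end is not a sink, can be prolonged. Conversely, a
    chain containing a source and a sink must start and end there. *)
Lemma maximal_chainP X :
  maximal_chain Q X <->
  exists s t, [/\ source Q s, sink Q t, connect Q s t & X = interval s t].
Proof.
split.
  case/andP=> /is_chainP[s [t [st ->]]] /forallP Xmax; exists s, t; split=> //.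
    have [s' ss' s's] := source_above Q s.
    have s't := connect_trans s's st.
    have /eqP/(congr1 fst)/setP/(_ s') : interval s' t == interval s t.
      apply: (implyP (Xmax (interval s' t))); apply/andP; split.
        by apply/is_chainP; exists s', t.
      apply/andP; split; apply/subsetP=> v; rewrite !inE.
        by case/andP=> sv ->; rewrite (connect_trans s's sv).
      by case/and3P=> -> sv ->; rewrite (connect_trans s's sv).
    rewrite !inE connect0 s't andbT => /esym/andP[ss _].
    by rewrite (connect_antisym ss s's).
  have [t' st' tt'] := sink_below Q t.
  have st2 := connect_trans st tt'.
  have /eqP/(congr1 fst)/setP/(_ t') : interval s t' == interval s t.
    apply: (implyP (Xmax (interval s t'))); apply/andP; split.
      by apply/is_chainP; exists s, t'.
    apply/andP; split; apply/subsetP=> v; rewrite !inE.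
      by case/andP=> -> vt; rewrite (connect_trans vt tt').
    by case/and3P=> -> -> vt; rewrite (connect_trans vt tt').
  rewrite !inE connect0 st2 => /esym/andP[_ t't].
  by rewrite -(connect_antisym t't tt').
case=> s [t [ss tt st ->]]; apply/andP; split.
  by apply/is_chainP; exists s, t.
apply/forallP => Y; apply/implyP => /andP[/is_chainP[s' [t' [_ ->]]]].
case/andP=> /subsetP sub _.
have := sub s; have := sub t; rewrite !inE !connect0 st.
by move=> /(_ isT)/andP[_ /(connect_sink tt)->] /(_ isT)/andP[/(connect_source ss)-> _].
Qed.

(** * Maximal chains of the support *)

Section Support.

Variable x : {ffun 'I_n -> option 'I_n}.
Hypotheses (px : path_function Q x) (mx : monotone Q x).

(* a_{ts} is in B_x *)
Definition in_x s t : bool := if x s is Some v then t \in over Q v else false.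

Lemma in_x_connect s t : in_x s t -> connect Q s t.
Proof.
rewrite /in_x; case xs: (x s) => [v|] //; have := px xs.
by rewrite !inE; apply: connect_trans.
Qed.

(** Monotonicity allows extension at the start, and transitivity of reachability allows it at the
    end. *)
Lemma in_x_closed s t s' t' :
  connect Q s' s -> connect Q t t' -> in_x s t -> in_x s' t'.
Proof.
move=> s's tt'; rewrite /in_x; case xs: (x s) => [v|] //.
have /mx/(_ xs)[w -> ] : s \in over Q s' by rewrite inE.
by rewrite !inE => wv vt; apply: connect_trans wv (connect_trans vt tt').
Qed.

(** If [i] and its value lie on the interval, the path between them extends to the whole interval.
    Conversely, the start [s] and its value serve as witnesses. *)
Lemma meets_interval s t : connect Q s t -> meets x (interval s t) = in_x s t.
Proof.
move=> st; apply/exists_inP/idP => [[i] | xst].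
  rewrite inE => /andP[si it] /exists_inP[j]; rewrite inE => /andP[sj jt] /eqP xi.
  by apply: (in_x_closed si jt); rewrite /in_x xi inE.
exists s; first by rewrite inE connect0.
move: xst; rewrite /in_x; case xs: (x s) => [v|] //; have := px xs.
by rewrite !inE => sv vt; apply/exists_inP; exists v; rewrite ?inE ?sv.
Qed.

(* The interval from s to t is a maximal chain of the support. *)
Definition full s t := [/\ source Q s, sink Q t & in_x s t].

Lemma supp_chainP X : reflect (exists2 st, full st.1 st.2 & X = interval st.1 st.2)
  (maximal_chain Q X && meets x X).
Proof.
apply: (iffP andP) => [[/maximal_chainP[s [t [ss tt st ->]]]] | [[s t] /= [ss tt xst] ->]].
  by rewrite meets_interval //; exists (s, t).
have st := in_x_connect xst; rewrite meets_interval //; split=> //.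
by apply/maximal_chainP; exists s, t.
Qed.

Lemma supp_vertexP v : reflect
  (exists2 st, full st.1 st.2 & connect Q st.1 v && connect Q v st.2)
  (v \in (supp Q x).1).
Proof.
apply: (iffP bigcupP) => [[X /supp_chainP[st fst ->]] | [st fst v_st]].
  by rewrite inE; exists st.
by exists (interval st.1 st.2); rewrite ?inE //; apply/supp_chainP; exists st.
Qed.

Lemma supp_arrowP u v : reflect
  (exists2 st, full st.1 st.2 & [&& Q u v, connect Q st.1 u & connect Q v st.2])
  ((u, v) \in (supp Q x).2).
Proof.
apply: (iffP bigcupP) => [[X /supp_chainP[st fst ->]] | [st fst v_st]].
  by rewrite inE; exists st.
by exists (interval st.1 st.2); rewrite ?inE //; apply/supp_chainP; exists st.
Qed.

End Support.

End Chains.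

(** * Ideals of the path algebra *)

Section PathIdeals.

Variables (k : fieldType) (n : nat) (Q : oriented_tree n).
Local Notation A := (path_algebra k Q).
Implicit Types (i j s t u v w : 'I_n) (p q r : qpath Q) (f g : A).
Implicit Types (D : pred (qpath Q)) (B : {vspace A}).

Lemma pelt_mulE p f r : (pelt k p * f) r = \sum_(q | qcomp p q == Some r) f q.
Proof.
rewrite ffunE (bigD1 p) //= [X in _ + X]big1 ?addr0 => [|q /negPf qp].
  by apply: eq_bigr => q _; rewrite ffunE eqxx mul1r.
by apply: big1 => q' _; rewrite ffunE qp mul0r.
Qed.

Lemma mul_peltE p f r : (f * pelt k p) r = \sum_(q | qcomp q p == Some r) f q.
Proof.
rewrite ffunE [RHS]big_mkcond; apply: eq_bigr => q _.
rewrite big_mkcond (bigD1 p) //= big1 => [|q' /negPf qp].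
  by rewrite addr0 ffunE eqxx mulr1.
by rewrite ffunE qp mulr0 if_same.
Qed.

Lemma idem_mulE i f r : (idem k Q i * f) r = if i == qtgt r then f r else 0.
Proof.
rewrite pelt_mulE; case: ifP => ir.
  by apply: big_pred1 => q; rewrite /= qcomp1l; case: (eqVneq q r) => [->|]; rewrite ?ir ?andbF.
by apply: big_pred0 => q; rewrite qcomp1l; case: (eqVneq q r) => [->|]; rewrite ?ir ?andbF.
Qed.

Lemma mul_idemE i f r : (f * idem k Q i) r = if i == qsrc r then f r else 0.
Proof.
rewrite mul_peltE; case: ifP => ir.
  by apply: big_pred1 => q; rewrite /= qcomp1r; case: (eqVneq q r) => [->|]; rewrite ?ir ?andbF.
by apply: big_pred0 => q; rewrite qcomp1r; case: (eqVneq q r) => [->|]; rewrite ?ir ?andbF.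
Qed.

Lemma pelt_mul q p r : qcomp q p == Some r -> pelt k q * pelt k p = pelt k r.
Proof.
move=> qpr; apply/ffunP => r'; rewrite pelt_mulE ffunE.
case: (eqVneq r' r) => [->|rr'].
  rewrite (bigD1 p) //= ffunE eqxx big1 ?addr0 // => p' /andP[_ /negPf pp'].
  by rewrite ffunE pp'.
apply: big1 => p' /eqP qp'; rewrite ffunE; case: eqP => // pp'.
by move: qpr rr'; rewrite -pp' qp' (inj_eq Some_inj) => ->.
Qed.

(** The corner between two vertices is at most one-dimensional, because paths are determined by
    their endpoints. *)
Lemma corner f p : idem k Q (qtgt p) * f * idem k Q (qsrc p) = f p *: pelt k p.
Proof.
apply/ffunP => r; rewrite mul_idemE idem_mulE !ffunE.
case: (eqVneq r p) => [->|rp]; first by rewrite !eqxx [RHS]mulr1.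
rewrite [RHS]mulr0; case: eqP => // sE; case: eqP => // tE.
by case/eqP: rp; apply: qpath_inj.
Qed.

Lemma pelt_neq0 p : pelt k p != 0.
Proof. by apply/eqP => /ffunP/(_ p)/eqP; rewrite !ffunE eqxx oner_eq0. Qed.

Lemma pelt_sum f : f = \sum_p f p *: pelt k p.
Proof.
apply/ffunP => r; rewrite sum_ffunE (bigD1 r) //= !ffunE eqxx [_ *: _]mulr1.
rewrite big1 ?addr0 // => p pr; rewrite !ffunE eq_sym (negPf pr).
exact: mulr0.
Qed.

Lemma sum_idem : \sum_i idem k Q i = 1 :> A.
Proof. by []. Qed.

Definition path_span D : {vspace A} := (\sum_(p | D p) <[pelt k p]>)%VS.

Lemma memv_path_span D f : reflect (forall p, f p != 0 -> D p) (f \in path_span D).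
Proof.
apply: (iffP memv_sumP) => [[g gD ->] p | fD].
  apply: contraNT => Dp; rewrite sum_ffunE big1 // => q Dq.
  have /vlineP[c ->] := gD q Dq; rewrite !ffunE; case: eqP => [pq|_].
    by rewrite pq Dq in Dp.
  exact: mulr0.
exists (fun p => f p *: pelt k p) => [p _|]; first exact: memvZ (memv_line _).
rewrite {1}[f]pelt_sum (bigID D) /= [X in _ + X]big1 ?addr0 // => p Dp.
by apply/eqP; rewrite scaler_eq0 -[_ == 0]negbK (contra (fD p)).
Qed.

Lemma pelt_path_span D p : (pelt k p \in path_span D) = D p.
Proof.
apply/memv_path_span/idP => [/(_ p)|Dp q]; rewrite ffunE.
  by rewrite eqxx oner_neq0; apply.
by case: (eqVneq q p) => [->|_] //; rewrite eqxx.
Qed.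

(** In a tree this says that [p] is a subpath of [q], that is, [q] equals [b p a] for some paths [a]
    and [b]. *)
Definition path_ext : rel (qpath Q) :=
  [rel p q | connect Q (qsrc q) (qsrc p) && connect Q (qtgt p) (qtgt q)].

Lemma qcomp_ext q p r : qcomp q p == Some r -> path_ext p r && path_ext q r.
Proof.
rewrite qcompE => /and3P[/eqP pq /eqP sr /eqP tr]; apply/andP; split.
  by apply/andP; rewrite sr tr connect0 pq qpath_connect.
by apply/andP; rewrite sr tr connect0 -pq qpath_connect.
Qed.

(** Any path in the support of a product extends a path in the support of each factor. *)
Lemma subbimodule_path_span D :
  (forall p q, D p -> path_ext p q -> D q) -> subbimodule (path_span D).
Proof.
move=> Dext; apply/andP; split; apply/prodvP => f g.
  move=> _ /memv_path_span gD; apply/memv_path_span => r; apply: contraNT => Dr.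
  rewrite ffunE big1 // => q _; rewrite big1 // => p /qcomp_ext/andP[pr _].
  by rewrite [g p](contraNeq (gD p)) ?mulr0 //; apply: contra Dr => /Dext/(_ pr).
move=> /memv_path_span fD _; apply/memv_path_span => r; apply: contraNT => Dr.
rewrite ffunE big1 // => q _; rewrite big1 // => p /qcomp_ext/andP[_ qr].
by rewrite [f q](contraNeq (fD q)) ?mul0r //; apply: contra Dr => /Dext/(_ qr).
Qed.

Section Subbimodule.

Variable B : {vspace A}.
Hypothesis Bid : subbimodule B.

Lemma subbimodule_mull f g : g \in B -> f * g \in B.
Proof. by case/andP: Bid => /prodvP BL _; apply: BL; rewrite memvf. Qed.

Lemma subbimodule_mulr f g : f \in B -> f * g \in B.
Proof. by case/andP: Bid => _ /prodvP BR fB; apply: BR; rewrite ?memvf. Qed.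

Lemma subbimodule_pelt f p : f \in B -> f p != 0 -> pelt k p \in B.
Proof.
move=> fB fp; rewrite -[pelt k p]scale1r -(mulVf fp) -scalerA -corner.
by apply/memvZ/subbimodule_mulr/subbimodule_mull.
Qed.

Lemma subbimoduleE : B = path_span [pred p | pelt k p \in B].
Proof.
apply/vspaceP => f; apply/idP/memv_path_span => [fB p | fB].
  exact: subbimodule_pelt.
rewrite [f]pelt_sum memv_suml // => p _; case: (eqVneq (f p) 0) => [->|/fB pB].
  by rewrite scale0r mem0v.
exact: memvZ.
Qed.

Lemma subbimodule_ext p q : path_ext p q -> pelt k p \in B -> pelt k q \in B.
Proof.
case/andP=> /qpath_of[a asrc atgt] /qpath_of[b bsrc btgt] pB.
have [pa pas pat] : exists2 r : qpath Q, qsrc r = qsrc q & qtgt r = qtgt p.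
  by apply: qpath_of; rewrite -asrc (connect_trans (qpath_connect a)) // atgt qpath_connect.
have -> : pelt k q = pelt k b * (pelt k p * pelt k a).
  by rewrite (@pelt_mul p a pa) ?(@pelt_mul b pa q) //
     qcompE ?pat ?pas ?atgt ?bsrc ?asrc ?btgt !eqxx.
exact/subbimodule_mull/subbimodule_mulr.
Qed.

Lemma subbimodule_neq0 : B != 0%VS -> exists p, pelt k p \in B.
Proof.
rewrite -vpick0 => /eqP B0.
case: (pickP (fun p => vpick B p != 0)) => [p pB | B00]; last first.
  by case: B0; apply/ffunP => p; rewrite ffunE; apply/eqP/negbFE/B00.
by exists p; apply: subbimodule_pelt pB; apply: memv_pick.
Qed.

End Subbimodule.

(** The coefficients of the two summands at [p] add up to 1, so one of them is nonzero, and that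
    ideal contains the path. *)
Lemma subbimodule_add B1 B2 p : subbimodule B1 -> subbimodule B2 ->
  pelt k p \in (B1 + B2)%VS -> (pelt k p \in B1) || (pelt k p \in B2).
Proof.
move=> B1id B2id /memv_addP[f fB1 [g gB2 /ffunP/(_ p)]].
rewrite !ffunE eqxx => fg; apply/orP.
case: (eqVneq (f p) 0) => [f0|/(subbimodule_pelt B1id fB1)]; last by left.
right; apply: (subbimodule_pelt B2id gB2).
by move/eqP: fg; rewrite f0 add0r eq_sym; apply: contraTneq => ->; rewrite eq_sym oner_eq0.
Qed.

(* A bimodule splits along any union of connected components of its paths. *)
Lemma indecomposable_component B D : indecomposable_subbimodule B ->
  (forall p q, pelt k p \in B -> path_ext p q -> D p = D q) ->
  forall p q, pelt k p \in B -> pelt k q \in B -> D p -> D q.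
Proof.
case=> Bid _ Bind DB p q pB qB Dp; apply: contraTT isT => Dq.
have ext r r' : pelt k r \in B -> path_ext r r' -> pelt k r' \in B.
  by move=> rB rr'; apply: subbimodule_ext rB.
(* If [q] were outside [D], the paths of [B] inside and outside [D] would span two nonzero
   complementary ideals. *)
pose B1 := path_span [pred r | (pelt k r \in B) && D r].
pose B2 := path_span [pred r | (pelt k r \in B) && ~~ D r].
have [] // := Bind B1 B2.
- apply: subbimodule_path_span => r r' /andP[rB Dr] rr'.
  by rewrite inE (ext _ _ rB rr') -(DB _ _ rB rr').
- apply: subbimodule_path_span => r r' /andP[rB Dr] rr'.
  by rewrite inE (ext _ _ rB rr') -(DB _ _ rB rr').
- by rewrite [RHS]subbimoduleE // [RHS](bigID D).
- apply/eqP; rewrite -subv0; apply/subvP => f /memv_capP[/memv_path_span f1 /memv_path_span f2].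
  rewrite memv0; apply/eqP/ffunP => r; rewrite ffunE; apply/eqP/negPn/negP => fr.
  by case/andP: (f1 _ fr) => _ Dr; case/andP: (f2 _ fr) => _; rewrite Dr.
- move=> B10; have : pelt k p \in B1 by rewrite pelt_path_span inE pB.
  by rewrite B10 memv0 (negPf (pelt_neq0 p)).
move=> B20; have : pelt k q \in B2 by rewrite pelt_path_span inE qB.
by rewrite B20 memv0 (negPf (pelt_neq0 q)).
Qed.

End PathIdeals.

(** * Columns of an ideal *)

Section RightDivision.

Variables (k : fieldType) (n : nat) (Q : oriented_tree n).
Local Notation A := (path_algebra k Q).
Variable a : qpath Q.
Implicit Types (c f g : A).

(* Inverse of the isomorphism [c e_v |-> c a] from P_v to A a, for a path [a] with
   target v. *)
Definition rdiv f : A := [ffun q => if qcomp q a is Some r then f r else 0].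

Lemma rdiv_is_linear : linear rdiv.
Proof.
move=> c f g; apply/ffunP => q; rewrite !ffunE; case: (qcomp q a) => [r|].
  by rewrite !ffunE.
by rewrite addr0 [RHS]mulr0.
Qed.

HB.instance Definition _ := GRing.isLinear.Build k A A *:%R rdiv rdiv_is_linear.

(** Multiplication by [a] moves the coefficient at [q] to the composite of [a] and [q], and kills
    the paths that do not start at the target of [a]. *)
Lemma rdiv_mul c : rdiv (c * pelt k a) = c * idem k Q (qtgt a).
Proof.
apply/ffunP => q; rewrite mul_idemE ffunE.
case E: (qcomp q a) => [r|]; last first.
  case: eqP => // aq; have [r rs rt] : exists2 r : qpath Q, qsrc r = qsrc a & qtgt r = qtgt q.
    by apply: qpath_of; rewrite (connect_trans (qpath_connect a)) // aq qpath_connect.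
  by have := qcompE q a r; rewrite E aq rs rt !eqxx.
have := qcompE q a r; rewrite E eqxx => /esym/and3P[aq /eqP rs /eqP rt].
rewrite aq mul_peltE; apply: big_pred1 => q' /=; rewrite qcompE.
apply/and3P/eqP => [[/eqP aq' _ /eqP rt']|->]; last by rewrite rs rt.
by apply: qpath_inj; rewrite -?rt // -aq' (eqP aq).
Qed.

Lemma idem_pelt : idem k Q (qtgt a) * pelt k a = pelt k a.
Proof. by apply: pelt_mul; rewrite qcomp1l !eqxx. Qed.

Lemma left_ideal_iso : left_module_iso ({:A} * <[pelt k a]>)%VS (proj k Q (qtgt a)).
Proof.
exists (linfun rdiv); split.
- apply/vspaceP => f; apply/memv_imgP/memv_cosetP => [[_ /memv_cosetP[c _ ->] ->]|[c _ ->]].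
    by exists c; rewrite ?memvf // lfunE /= rdiv_mul.
  exists (c * pelt k a); first by apply/memv_cosetP; exists c; rewrite ?memvf.
  by rewrite lfunE /= rdiv_mul.
- move=> _ _ /memv_cosetP[c _ ->] /memv_cosetP[c' _ ->].
  by rewrite !lfunE /= !rdiv_mul -[pelt k a]idem_pelt !mulrA => ->.
move=> b _ /memv_cosetP[c _ ->].
by rewrite !lfunE /= mulrA !rdiv_mul mulrA.
Qed.

End RightDivision.

Section Columns.

Variables (k : fieldType) (n : nat) (Q : oriented_tree n).
Local Notation A := (path_algebra k Q).
Implicit Types (i j s t u v w : 'I_n) (p q r a : qpath Q) (f g : A).
Implicit Types (D : pred (qpath Q)) (B : {vspace A}).

Lemma idem_mul_neq0 i f : idem k Q i * f != 0 -> exists2 p, f p != 0 & qtgt p = i.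
Proof.
case: (pickP (fun p => (f p != 0) && (i == qtgt p))) => [p /andP[fp /eqP ip]|f0].
  by exists p.
case/eqP; apply/ffunP => r; rewrite idem_mulE ffunE; case: eqP => // ir.
by apply/eqP/negbFE; rewrite -[RHS](f0 r) ir eqxx andbT.
Qed.

(** An isomorphism preserves the nonvanishing of components at each idempotent. The generator of
    each side therefore forces a path from [w] to the target of [a] and one back, and the tree has
    no directed cycles. *)
Lemma left_ideal_iso_uniq a w :
  left_module_iso ({:A} * <[pelt k a]>)%VS (proj k Q w) -> w = qtgt a.
Proof.
case=> f [fU finj fM].
have inU c : c * pelt k a \in ({:A} * <[pelt k a]>)%VS.
  by apply/memv_cosetP; exists c; rewrite ?memvf.
have aU : pelt k a \in ({:A} * <[pelt k a]>)%VS by rewrite -[X in X \in _]mul1r.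
have f0 b : b \in ({:A} * <[pelt k a]>)%VS -> (f b == 0) = (b == 0).
  move=> bU; apply/eqP/eqP => [fb|->]; last exact: linear0.
  by apply: finj; rewrite ?mem0v // fb linear0.
have [c _ faE] : exists2 c, c \in {:A}%VS & f (pelt k a) = c * idem k Q w.
  by apply/memv_cosetP; rewrite -/(proj k Q w) -fU memv_img.
have : idem k Q (qtgt a) * f (pelt k a) != 0.
  by rewrite -fM // idem_pelt f0 // pelt_neq0.
case/idem_mul_neq0 => p; rewrite faE mul_idemE; case: (w =P qsrc p) => [wp _ pa | _ /eqP //].
apply: (@connect_antisym _ Q); first by rewrite wp -pa qpath_connect.
have /memv_imgP[_ /memv_cosetP[d _ ->] fwE] : idem k Q w \in (f @: ({:A} * <[pelt k a]>))%VS.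
  by rewrite fU -[X in X \in _]mul1r memv_mul ?memvf ?memv_line.
have : idem k Q w * (d * pelt k a) != 0.
  rewrite mulrA -f0 // -mulrA fM // -fwE (@pelt_mul _ _ _ _ _ (trivial_path Q w)) ?pelt_neq0 //.
  by rewrite qcomp1l !eqxx.
case/idem_mul_neq0 => r; rewrite mul_peltE => rN0 <-.
case: (pickP (fun q => qcomp q a == Some r)) => [q /qcomp_ext/andP[/andP[]] //|r0].
by rewrite big_pred0 ?eqxx in rN0.
Qed.

Lemma mul_idem_path_span D i :
  (path_span k D * <[idem k Q i]>)%VS = path_span k [pred p | D p && (qsrc p == i)].
Proof.
apply/vspaceP => f; apply/memv_cosetP/memv_path_span => [[g /memv_path_span gD ->] p|fD].
  rewrite mul_idemE inE [i == _]eq_sym; case: (qsrc p =P i) => [_ /gD ->|] //.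
  by rewrite eqxx.
exists f; first by apply/memv_path_span => p /fD/andP[].
apply/ffunP => p; rewrite mul_idemE; case: eqP => // ip; apply/eqP/negPn/negP => /fD.
by rewrite inE => /andP[_ /eqP pi]; case: ip.
Qed.

Lemma left_ideal_path_span a : ({:A} * <[pelt k a]>)%VS =
  path_span k [pred p | (qtgt p \in over Q (qtgt a)) && (qsrc p == qsrc a)].
Proof.
apply: subv_anti; apply/andP; split.
  apply/prodvP => c _ _ /vlineP[d ->]; rewrite -scalerAr memvZ //.
  apply/memv_path_span => r; rewrite mul_peltE => rN0.
  case: (pickP (fun q => qcomp q a == Some r)) => [q|r0].
    rewrite qcompE !inE => /and3P[/eqP -> -> /eqP->].
    by rewrite qpath_connect.
  by rewrite big_pred0 ?eqxx in rN0.
apply/subv_sumP => p /andP[]; rewrite inE => /qpath_of[q qs qt] /eqP pa.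
rewrite -memvE -(@pelt_mul _ _ _ q a p) ?memv_mul ?memvf ?memv_line //.
by rewrite qcompE qs qt pa !eqxx.
Qed.

Variable x : {ffun 'I_n -> option 'I_n}.

Lemma B_ofE : B_of k Q x = path_span k [pred p | in_x Q x (qsrc p) (qtgt p)].
Proof. by []. Qed.

(** The idempotents sum to 1. Only absorption on the left is assumed, so this covers [B_of] before
    monotonicity is known. *)
Lemma bimod_colE B i : (forall f g, g \in B -> f * g \in B) ->
  bimod_col B i = (B * <[idem k Q i]>)%VS.
Proof.
move=> BL; apply: subv_anti; apply/andP; split.
  by apply/subv_sumP => j _; apply: prodvSl; apply/prodvP => f g _; apply: BL.
apply/prodvP => f e fB ei; rewrite -[f]mul1r -sum_idem !mulr_suml.
by apply: memv_sumr => j _; rewrite !memv_mul ?memv_line.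
Qed.

Lemma B_of_mull f g : g \in B_of k Q x -> f * g \in B_of k Q x.
Proof.
move=> /memv_path_span gx; apply/memv_path_span => r; apply: contraNT => xr.
rewrite ffunE big1 // => q _; rewrite big1 // => p qpr.
rewrite [g p](contraNeq (gx p)) ?mulr0 //; apply: contra xr.
move: qpr; rewrite qcompE => /and3P[/eqP pq /eqP-> /eqP->].
case: (x _) => // v; rewrite !inE => vp.
by rewrite (connect_trans vp) // pq qpath_connect.
Qed.

Hypothesis px : path_function Q x.

(** When [x i] is a vertex, column [i] is the left ideal generated by the path from [i] to it, hence
    isomorphic to that projective and to no other. Otherwise the column vanishes. *)
Lemma x_of_B_of : x_of (B_of k Q x) = x.
Proof.
apply/ffunP => i; rewrite ffunE (bimod_colE i B_of_mull) B_ofE mul_idem_path_span.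
case xi: (x i) => [v|]; last first.
  rewrite [path_span _ _]big_pred0 ?eqxx // => p /=.
  by case: (eqVneq (qsrc p) i) => [pi|]; rewrite ?andbF // /in_x pi xi.
have : connect Q i v by have := px xi; rewrite inE.
case/qpath_of=> a ai av.
set U := path_span _ _; have {U}-> : U = ({:A} * <[pelt k a]>)%VS.
  rewrite left_ideal_path_span; apply: eq_bigl => p /=; rewrite ai.
  by case: (eqVneq (qsrc p) i) => [pi|]; rewrite ?andbF // /in_x pi xi av.
case: ifP => [|_].
  move/eqP/vspaceP/(_ (pelt k a)); rewrite memv0 (negPf (pelt_neq0 _ _)).
  by rewrite -[X in X \in _]mul1r memv_mul ?memvf ?memv_line.
case: pickP => [w /asboolP/left_ideal_iso_uniq -> | /(_ v)]; first by rewrite av.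
by move/asboolP; case; rewrite -av; apply: left_ideal_iso.
Qed.

End Columns.

(** * Special functions and indecomposable ideals *)

Section Correspondence.

Variables (k : fieldType) (n : nat) (Q : oriented_tree n).
Hypotheses (n1 : (1 < n)%N) (hadm : admissible Q).
Local Notation A := (path_algebra k Q).
Implicit Types (i j s t u v w y z : 'I_n) (p q r : qpath Q) (B : {vspace A}).
Implicit Types (x : {ffun 'I_n -> option 'I_n}).

Lemma pelt_B_of x p : (pelt k p \in B_of k Q x) = in_x Q x (qsrc p) (qtgt p).
Proof. by rewrite B_ofE pelt_path_span. Qed.

(** Below a non-source the order is linear. At a source whose trivial path is not in [B],
    indecomposability puts all targets into one branch, so both paths begin with the same arrow, and
    the order below its head is linear. *)
Lemma column_comparable B p q : indecomposable_subbimodule B ->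
  pelt k p \in B -> pelt k q \in B -> qsrc p = qsrc q ->
  pelt k (trivial_path Q (qsrc p)) \notin B ->
  connect Q (qtgt p) (qtgt q) || connect Q (qtgt q) (qtgt p).
Proof.
move=> Bind pB qB; set i := qsrc p => qi tiB.
have [ip iq] : connect Q i (qtgt p) /\ connect Q i (qtgt q).
  by rewrite {2}qi !qpath_connect.
case: (boolP (source Q i)) => [si|si]; last exact: over_linear ip iq.
(* Only the trivial path ends at a source. Hence extending a path of [B] at its target never crosses
   [i], and its branch is preserved. *)
have tgtN r : pelt k r \in B -> qtgt r != i.
  apply: contraTneq => ri; rewrite (_ : r = trivial_path Q i) //.
  have := qpath_connect r; rewrite ri => /(connect_source si) r_i.
  by apply: qpath_inj; rewrite ?r_i ?ri.
have [|y iy yp] := connect_first ip; first by rewrite eq_sym tgtN.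
have [|z iz zq] := connect_first iq; first by rewrite eq_sym tgtN.
suff yz : y = z by apply: over_linear yp _; rewrite ?yz ?(not_source iz).
have Bcomp := indecomposable_component (D := fun r => connect (avoid Q i) y (qtgt r)) Bind.
apply: (@no_detour _ Q i); rewrite /adj ?iy ?iz //.
apply: (@connect_trans _ _ (qtgt q)); last first.
  by rewrite avoid_csym; apply: connect_avoid; rewrite // arrow_connectF.
apply: (Bcomp _ p q) => //; last by apply: connect_avoid; rewrite // arrow_connectF.
move=> r r' rB /andP[_ rr']; apply: same_connect_r; first exact: avoid_csym.
apply: connect_avoid => //; apply: contra (tgtN _ rB) => /andP[ri _].
by rewrite (connect_source si ri).
Qed.

Definition col_tgt B i : pred 'I_n :=
  [pred t | [exists p : qpath Q, [&& qsrc p == i, qtgt p == t & pelt k p \in B]]].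

Lemma column_min B p : indecomposable_subbimodule B -> pelt k p \in B ->
  exists2 v, col_tgt B (qsrc p) v
    & forall t, col_tgt B (qsrc p) t -> connect Q v t.
Proof.
move=> Bind pB; set i := qsrc p.
case: (boolP (pelt k (trivial_path Q i) \in B)) => [tB|tB].
  exists i; first by apply/existsP; exists (trivial_path Q i); rewrite tB !eqxx.
  by move=> t /existsP[q /and3P[/eqP<- /eqP<- _]]; apply: qpath_connect.
have pt : col_tgt B i (qtgt p) by apply/existsP; exists p; rewrite pB !eqxx.
(* Targets in the column are pairwise comparable, so the one with the most vertices below it reaches
   all others. *)
case: (@arg_maxnP _ (qtgt p) (col_tgt B i) (fun v => #|over Q v|) pt) => v vB vmax.
exists v => // t tB'; have := vmax t tB'.
case/existsP: vB => q /and3P[/eqP qi /eqP <- qB].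
case/existsP: tB' => r /and3P[/eqP ri /eqP <- rB].
have /orP[//|rq] : connect Q (qtgt q) (qtgt r) || connect Q (qtgt r) (qtgt q).
  by apply: (@column_comparable B); rewrite ?qi ?ri.
case: (eqVneq (qtgt r) (qtgt q)) => [->|rqN]; first by rewrite connect0.
by rewrite /= leqNgt card_over_lt.
Qed.

Lemma indecomposable_B_of B : indecomposable_subbimodule B ->
  exists2 x, path_function Q x & B = B_of k Q x.
Proof.
move=> Bind; have [Bid _ _] := Bind.
pose x := [ffun i => [pick v | col_tgt B i v && [forall t, col_tgt B i t ==> connect Q v t]]].
exists x => [i v|].
  rewrite ffunE; case: pickP => // w /andP[/existsP[p /and3P[/eqP<- /eqP<- _]] _] [<-].
  by rewrite inE qpath_connect.
rewrite {1}(subbimoduleE Bid) B_ofE; apply: eq_bigl => p /=.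
rewrite /in_x ffunE.
case: pickP => [v /andP[/existsP[q /and3P[/eqP qp /eqP qv qB]] /forallP vmin] | noV].
  rewrite inE; apply/idP/idP => [pB|vp].
    by apply: (implyP (vmin _)); apply/existsP; exists p; rewrite pB !eqxx.
  by apply: (subbimodule_ext Bid (p := q)) => //; apply/andP; rewrite qp connect0 qv.
apply/negP => pB; have [v vB vmin] := column_min Bind pB.
case/negP: (negbT (noV v)); rewrite vB; apply/forallP => t; apply/implyP; exact: vmin.
Qed.

(** The path from [i] to its value lies in the ideal; prolonging it backwards to [j] gives a path in
    column [j]. *)
Lemma subbimodule_monotone x :
  path_function Q x -> subbimodule (B_of k Q x) -> monotone Q x.
Proof.
move=> px Bid i j v; rewrite inE => ji xi.
have iv : connect Q i v by have := px _ _ xi; rewrite inE.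
have [p ps pt] := qpath_of iv; have [q qs qt] := qpath_of (connect_trans ji iv).
have : pelt k q \in B_of k Q x.
  apply: (subbimodule_ext Bid (p := p)).
    by apply/andP; rewrite ps qs pt qt connect0.
  by rewrite pelt_B_of ps pt /in_x xi inE connect0.
by rewrite pelt_B_of qs qt /in_x; case: (x j) => // w; exists w.
Qed.

Section Special.

Variable x : {ffun 'I_n -> option 'I_n}.
Hypotheses (px : path_function Q x) (mx : monotone Q x).

Lemma subbimodule_B_of : subbimodule (B_of k Q x).
Proof.
rewrite B_ofE; apply: subbimodule_path_span => p q xp /andP[qp pq].
exact: in_x_closed xp.
Qed.

Lemma full_above s t : in_x Q x s t ->
  exists2 st, full Q x st.1 st.2 & connect Q st.1 s && connect Q t st.2.
Proof.
move=> xst; have [s' ss' s's] := source_above Q s; have [t' st' tt'] := sink_below Q t.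
exists (s', t'); last by rewrite s's tt'.
by split=> //; apply: in_x_closed xst.
Qed.

Lemma edge_csym (X : graph n) : connect_sym (edge X).
Proof. by apply: sym_connect_sym => u v; apply: adj_sym. Qed.

(** A path of the ideal extends to a full interval from a source to a sink, all of whose arrows
    belong to the support. *)
Lemma connect_supp s t u v : in_x Q x s t ->
  connect Q s u -> connect Q u v -> connect Q v t -> connect (edge (supp Q x)) u v.
Proof.
move=> /full_above[[s' t'] /= fst /andP[s's tt']] su /connectP[a].
elim: a u su => [|w a IHa] u su /=; first by move=> _ ->; rewrite connect0.
case/andP=> uw wa vE vt; have su' := connect_trans su (connect1 uw).
apply: connect_trans (IHa w su' wa vE vt); apply/connect1/orP; left.
apply/(supp_arrowP px mx); exists (s', t') => //=.
rewrite uw (connect_trans s's su) (connect_trans _ (connect_trans vt tt')) //.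
by apply/connectP; exists a.
Qed.

(** * From indecomposable ideals to special functions *)

Section Indecomposable.

Hypothesis Bind : indecomposable_subbimodule (B_of k Q x).

Lemma in_x_component (D : rel 'I_n) :
  (forall s t s' t', in_x Q x s t -> connect Q s' s -> connect Q t t' ->
    D s t = D s' t') ->
  forall s t s' t', in_x Q x s t -> in_x Q x s' t' -> D s t -> D s' t'.
Proof.
move=> DP s t s' t' xst xst'.
have [p ps pt] := qpath_of (in_x_connect px xst).
have [q qs qt] := qpath_of (in_x_connect px xst').
rewrite -{}ps -{}pt -{}qs -{}qt in xst xst' *.
apply: (indecomposable_component (D := fun r => D (qsrc r) (qtgt r)) Bind).
- by move=> r r'; rewrite pelt_B_of => xr /andP[]; apply: DP.
- by rewrite pelt_B_of.
- by rewrite pelt_B_of.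
Qed.

Lemma indecomposable_special : special Q x.
Proof.
split=> //.
  move=> i j /(supp_vertexP px mx)[[s t] /= [_ _ xst] /andP[si it]].
  case/(supp_vertexP px mx)=> -[s' t'] /= [_ _ xst'] /andP[s'j jt'].
  have ss' : connect (edge (supp Q x)) s s'.
    (* Paths are classified by the support component of their start, which extension preserves by
       [connect_supp]. *)
    pose D u (_ : 'I_n) := connect (edge (supp Q x)) s u.
    apply: (@in_x_component D _ s t s' t') => //; last exact: connect0.
    move=> a b a' b' xab a'a bb'; apply: same_connect_r; first exact: edge_csym.
    rewrite edge_csym; apply: (@connect_supp a' b) => //; last exact: in_x_connect xab.
    exact: in_x_closed xab.
  apply: connect_trans (connect_supp xst' (connect0 _ _) s'j jt').
  rewrite edge_csym; rewrite edge_csym in ss'; apply: (connect_trans ss').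
  exact: connect_supp xst (connect0 _ _) si it.
move=> i; rewrite !inE => /andP[iK /(supp_vertexP px mx)[[s t] /= [ss st xst] /andP[si it]]] xi.
have xiF t' : in_x Q x i t' = false by rewrite /in_x xi.
(* A source on a full interval is its start, so its value would be nonzero; only a sink remains. *)
have ti : sink Q i.
  by case/orP: iK => // /connect_source/(_ si) si'; rewrite si' xiF in xst.
have sNi : s != i by apply/eqP => si'; apply: (source_sinkF n1 ss); rewrite si'.
have [y sy yi] := connect_last si sNi.
rewrite -(cards1 y); apply: eq_card => j; rewrite !inE.
apply/orP/eqP => [[|]|->]; last 1 first.
- by right; apply/(supp_arrowP px mx); exists (s, t); rewrite //= yi sy.
- by case/(supp_arrowP px mx)=> st' _ /and3P[/not_sink]; rewrite ti.
case/(supp_arrowP px mx)=> -[s' t'] /= [_ _ xst'] /and3P[ji s'j _].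
have avoidi a b : connect Q a b -> Q b i -> connect (avoid Q i) a b.
  by move=> ab bi; apply: connect_avoid; rewrite // (arrow_connectF bi) andbF.
apply/esym/(@no_detour _ Q i); rewrite /adj ?yi ?ji ?orbT //.
apply: connect_trans (avoidi _ _ s'j ji).
(* Now paths are classified by the branch at [i] containing their start. No path of the ideal starts
   at the sink [i], so extension preserves the branch, and all support arrows into [i] come from one
   branch. *)
pose D u (_ : 'I_n) := connect (avoid Q i) y u.
apply: (@in_x_component D _ s t s' t') => //; last by rewrite /D avoid_csym avoidi.
move=> a b a' b' xab a'a _; apply: same_connect_r; first exact: avoid_csym.
rewrite avoid_csym; apply: connect_avoid => //.
by apply/negP => /andP[_ /(connect_sink ti) ai]; rewrite ai xiF in xab.
Qed.

End Indecomposable.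

(** * From special functions to indecomposable ideals *)

Section Splitting.

Hypothesis spx : special Q x.
Variables B1 B2 : {vspace A}.
Hypotheses (B1id : subbimodule B1) (B2id : subbimodule B2).
Hypotheses (B12 : (B1 + B2)%VS = B_of k Q x) (B120 : (B1 :&: B2)%VS = 0%VS).

(* a_{ts} is in B *)
Definition side B s t := [exists p : qpath Q, [&& qsrc p == s, qtgt p == t & pelt k p \in B]].

Lemma side_closed B s t s' t' : subbimodule B ->
  connect Q s' s -> connect Q t t' -> side B s t -> side B s' t'.
Proof.
move=> Bid s's tt' /existsP[p /and3P[/eqP ps /eqP pt pB]].
have st : connect Q s t by rewrite -ps -pt qpath_connect.
have [q qs qt] := qpath_of (connect_trans s's (connect_trans st tt')).
apply/existsP; exists q; rewrite qs qt !eqxx /=.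
by apply: subbimodule_ext pB => //; apply/andP; rewrite ps pt qs qt.
Qed.

Lemma side_or s t : in_x Q x s t -> side B1 s t || side B2 s t.
Proof.
move=> xst; have [p ps pt] := qpath_of (in_x_connect px xst).
have : pelt k p \in (B1 + B2)%VS by rewrite B12 pelt_B_of ps pt.
case/subbimodule_add/orP=> // pB; apply/orP; [left | right];
  by apply/existsP; exists p; rewrite ps pt !eqxx.
Qed.

Lemma side_disjoint s t : side B1 s t -> side B2 s t -> False.
Proof.
case/existsP=> p /and3P[/eqP ps /eqP pt pB1] /existsP[q /and3P[/eqP qs /eqP qt qB2]].
have pq : p = q by apply: qpath_inj; rewrite ?ps ?pt.
have : pelt k p \in (B1 :&: B2)%VS by rewrite memv_cap pB1 pq.
by rewrite B120 memv0 (negPf (pelt_neq0 _ _)).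
Qed.

(** The trivial path at [j] belongs to one summand, and every path through [j] extends it. *)
Lemma side_at j s t s' t' : in_x Q x j j ->
  connect Q s j -> connect Q j t -> connect Q s' j -> connect Q j t' ->
  side B1 s t -> side B1 s' t'.
Proof.
move=> xj sj jt s'j jt' B1st; case/orP: (side_or xj) => jB.
  exact: (side_closed B1id s'j jt').
by case: (side_disjoint B1st); apply: (side_closed B2id sj jt).
Qed.

(** Either the trivial path at [j] is in the ideal and links the two intervals, or the intervals
    coincide. *)
Lemma side_same j s t s' t' : full Q x s t -> full Q x s' t' ->
  connect Q s j -> connect Q j t -> connect Q s' j -> connect Q j t' ->
  side B1 s t -> side B1 s' t'.
Proof.
move=> [ss tt xst] [ss' tt' xst'] sj jt s'j jt'.
case: (boolP (in_x Q x j j)) => [xj|xj]; first exact: side_at xj sj jt s'j jt'.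
have [_ _ _ degx] := spx.
suff [-> ->] : s = s' /\ t = t' by [].
(* At a source, the value of [x] is a vertex other than [j], hence a non-source, and only one sink
   lies below it. *)
case: (boolP (source Q j)) => sourcej.
  have sE := connect_source sourcej sj; have s'E := connect_source sourcej s'j.
  rewrite sE s'E; split=> //; move: xst xst' xj; rewrite sE s'E /in_x.
  case xj: (x j) => [v|] //; rewrite !inE => vt vt' vj.
  have jv : connect Q j v by have := px xj; rewrite inE.
  apply: (sink_below_uniq hadm _ tt tt' vt vt').
  by apply: connect_not_source jv _; apply: contraNneq vj => ->; rewrite connect0.
case: (boolP (sink Q j)) => sinkj; last first.
  by split; [apply: (source_above_uniq hadm sinkj) | apply: (sink_below_uniq hadm sourcej)].
split; last by rewrite (connect_sink sinkj jt) (connect_sink sinkj jt').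
(* At a sink the only possible nonzero value is [j] itself, which is excluded. The degree condition
   then leaves a single support arrow into [j]; its tail is not a sink, so only one source lies
   above it. *)
have jE : x j = None.
  case xjE: (x j) => [v|] //; move: xj; rewrite /in_x xjE inE.
  have /(connect_sink sinkj) -> : connect Q j v by have := px xjE; rewrite inE.
  by rewrite connect0.
have notj a : source Q a -> a != j by apply: contraTneq => ->.
have [y sy yj] := connect_last sj (notj _ ss).
have [z s'z zj] := connect_last s'j (notj _ ss').
have jK : j \in KQ Q :&: (supp Q x).1.
  by rewrite !inE sinkj; apply/(supp_vertexP px mx); exists (s, t); rewrite //= sj.
have /eqP/cards1P[w wE] := degx j jK jE.
have in_edges a b c : full Q x b c -> connect Q b a -> Q a j -> connect Q j c -> a = w.
  move=> fbc ba aj jc; apply/set1P; rewrite -wE inE; apply/orP; right.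
  by apply/(supp_arrowP px mx); exists (b, c); rewrite //= aj ba.
have yw : y = w by apply: (in_edges y s t).
have zw : z = w by apply: (in_edges z s' t').
rewrite yw -zw in sy yj.
exact: (source_above_uniq hadm (not_sink zj)).
Qed.

(** If both summands were nonzero, each would contain a full interval; a walk in the connected
    support carries the first summand over to the interval of the second, against disjointness. *)
Lemma side_empty : B1 = 0%VS \/ B2 = 0%VS.
Proof.
case: (eqVneq B1 0%VS) => [|/subbimodule_neq0[]// p1 p1B]; first by left.
case: (eqVneq B2 0%VS) => [|/subbimodule_neq0[]// p2 p2B]; first by right.
have side_full B p : subbimodule B -> (B <= B_of k Q x)%VS -> pelt k p \in B ->
    exists2 st, full Q x st.1 st.2 & side B st.1 st.2.
  move=> Bid BB pB; have := subvP BB _ pB; rewrite pelt_B_of.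
  case/full_above=> st fst /andP[sp pt]; exists st => //.
  by apply: (side_closed Bid sp pt); apply/existsP; exists p; rewrite pB !eqxx.
have [|[s1 t1] /= f1 b1] := side_full _ _ B1id _ p1B; first by rewrite -B12 addvSl.
have [|[s2 t2] /= f2 b2] := side_full _ _ B2id _ p2B; first by rewrite -B12 addvSr.
have con s t : full Q x s t -> connect Q s t by case=> _ _ /(in_x_connect px).
have insupp s t : full Q x s t -> s \in (supp Q x).1.
  by move=> fst; apply/(supp_vertexP px mx); exists (s, t); rewrite //= connect0 con.
have [_ _ conx _] := spx.
have /connectP[a s1a s2E] := conx _ _ (insupp _ _ f1) (insupp _ _ f2).
(* Invariant of the walk: all full intervals through the current vertex lie in [B1]. *)
have : forall s t, full Q x s t -> connect Q s s1 -> connect Q s1 t -> side B1 s t.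
  move=> s t fst ss1 s1t.
  by apply: (@side_same s1 s1 t1 s t) => //; apply: con.
elim: a s1 s1a s2E {b1 f1 p1B} => [|v a IHa] u /=.
  move=> _ <- /(_ s2 t2 f2 (connect0 _ _) (con _ _ f2)) b1.
  by case: (side_disjoint b1 b2).
case/andP=> uv va s2E uB; apply: (IHa v) => // s t fst sv vt.
(* A full interval containing the arrow between [u] and [v] passes through both vertices and
   transfers the invariant. *)
have [[s' t'] /= fst' /and4P[s'u ut' s'v vt']] : exists2 st, full Q x st.1 st.2 &
    [&& connect Q st.1 u, connect Q u st.2, connect Q st.1 v & connect Q v st.2].
  case/orP: uv => /(supp_arrowP px mx)[st fst' /and3P[uv su vt0]]; exists st => //.
    rewrite su vt0 (connect_trans su (connect1 uv)).
    by rewrite (connect_trans (connect1 uv) vt0).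
  rewrite su vt0 (connect_trans su (connect1 uv)).
  by rewrite (connect_trans (connect1 uv) vt0).
by apply: (@side_same v s' t' s t) => //; apply: uB.
Qed.

End Splitting.

Lemma special_indecomposable : special Q x ->
  indecomposable_subbimodule (B_of k Q x) \/ B_of k Q x = 0%VS.
Proof.
move=> spx; case: (eqVneq (B_of k Q x) 0%VS) => [|B0]; first by right.
left; split=> //; first exact: subbimodule_B_of.
by move=> B1 B2 B1id B2id B12 B120; apply: side_empty.
Qed.

End Special.

Lemma B_of_none : B_of k Q [ffun=> None] = 0%VS.
Proof. by rewrite B_ofE /path_span big_pred0 // => p; rewrite /= /in_x ffunE. Qed.

Lemma special_none : special Q [ffun=> None].
Proof.
have px : path_function Q [ffun=> None] by move=> i j; rewrite ffunE.
have mx : monotone Q [ffun=> None] by move=> i j v _; rewrite ffunE.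
have supp0 v : (v \in (supp Q [ffun=> None]).1) = false.
  by apply/(supp_vertexP px mx) => -[st [_ _]]; rewrite /in_x ffunE.
by split=> // [i j|i]; rewrite ?inE supp0 ?andbF.
Qed.

Lemma subbimodule_special B : indecomposable_subbimodule B \/ B = 0%VS ->
  exists2 x, special Q x & B = B_of k Q x.
Proof.
case=> [Bind|->]; last by exists [ffun=> None]; [apply: special_none | rewrite B_of_none].
have [x px BE] := indecomposable_B_of Bind; exists x => //; rewrite BE in Bind.
apply: indecomposable_special => //; apply: subbimodule_monotone => //.
by case: Bind.
Qed.

End Correspondence.

Theorem theorem43 (k : closedFieldType) (n : nat) (hn : (1 < n)%N)
    (Q : oriented_tree n) (hadm : admissible Q) (hK : KQ' Q != set0) :
  [/\ forall B : {vspace path_algebra k Q},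
        indecomposable_subbimodule B \/ B = 0%VS -> special Q (x_of B),
      forall x : {ffun 'I_n -> option 'I_n},
        special Q x ->
          indecomposable_subbimodule (B_of k Q x) \/ B_of k Q x = 0%VS,
      forall B : {vspace path_algebra k Q},
        indecomposable_subbimodule B \/ B = 0%VS -> B_of k Q (x_of B) = B,
      forall x : {ffun 'I_n -> option 'I_n},
        special Q x -> x_of (B_of k Q x) = x
    & x_of (0%VS : {vspace path_algebra k Q}) = [ffun=> None] /\
      B_of k Q [ffun=> None] = 0%VS].
Proof.
(* Since every ideal in question is [B_of k Q x] for a special [x], this one-sided inverse also
   gives the other one. *)
have x_ofK x : special Q x -> x_of (B_of k Q x) = x by case=> px *; apply: x_of_B_of.
split=> //.
- by move=> B /(subbimodule_special hn hadm)[x spx ->]; rewrite x_ofK.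
- by move=> x spx; have [px mx _ _] := spx; apply: special_indecomposable.
- by move=> B /(subbimodule_special hn hadm)[x spx ->]; rewrite x_ofK.
by rewrite -(B_of_none k Q) x_ofK //; apply: special_none.
Qed.
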